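(* Let $X$ be a pre-Hilbert space, $C$ a convex subset of $X$ whose diameter is bounded by a positive natural number $b$, $U$ a nonexpansive function that maps $C$ into $C$, and $v_0$ a point of $C$. For any $k\in\mathbb{N}$ and $f:\mathbb{N}\to\mathbb{N}$, there is $N\in\mathbb{N}$ such that $N\leq(\tilde f+1)^{(r)}(0)$ and $$\exists x\in C\left(\|U(x)-x\|<\frac{1}{\tilde f(N)+1}\ \wedge\ \forall y\in C\left(\|U(y)-y\|\leq\frac{1}{N+1}\to\|x-v_0\|^2<\|y-v_0\|^2+\frac{1}{k+1}\right)\right),$$ where $r:=b^2(k+1)$ and $(\tilde f+1)^{(r)}$ is the $r$-fold composition of the function $\tilde f+1$.
   Context: $\mathbb{N}=\{0,1,2,\ldots\}$. For $f:\mathbb{N}\to\mathbb{N}$, $\tilde f(n):=\max_{k\leq n}f(k)$, and $\tilde f+1$ is the function $n\mapsto\tilde f(n)+1$. A map $U$ is nonexpansive if $\|U(x)-U(y)\|\leq\|x-y\|$ for all $x,y$. *)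

(* Defs.v *)
From HB Require Import structures.
From mathcomp Require Import all_boot all_order all_algebra.
From mathcomp Require Import sesquilinear complex.
From mathcomp Require Import all_classical all_reals all_analysis.

Set Implicit Arguments.
Unset Strict Implicit.
Unset Printing Implicit Defensive.

Import Order.TTheory GRing.Theory Num.Theory.

Local Open Scope classical_set_scope.
Local Open Scope ring_scope.

(* A pre-Hilbert space is taken over the reals or over the complex numbers;
   both cases are handled at once by a code [s] for the scalar field. *)
Variant scalars := RealScalars | ComplexScalars.

Definition scalar_field (R : realType) (s : scalars) : numFieldType :=
  match s with
  | RealScalars => R
  | ComplexScalars => R[i]
  end.

Definition scalar_conj (R : realType) (s : scalars) :
    scalar_field R s -> scalar_field R s :=
  match s return scalar_field R s -> scalar_field R s with
  | RealScalars => idfun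
  | ComplexScalars => @conjc R
  end.

Definition scalar_re (R : realType) (s : scalars) : scalar_field R s -> R :=
  match s return scalar_field R s -> R with
  | RealScalars => idfun
  | ComplexScalars => @complex.Re R
  end.

(* [{dot X for theta}] is the type of positive definite hermitian forms on [X];
   they are linear in the first argument and [theta]-semilinear in the
   second. *)
Notation inner_product R s X := {dot X for @scalar_conj R s}.

(* [ip x x] is a nonnegative real number, seen in the scalar field. *)
Definition ip_norm (R : realType) (s : scalars)
    (X : lmodType (scalar_field R s)) (ip : inner_product R s X) (x : X) : R :=
  Num.sqrt (scalar_re (ip x x)).

Definition diameter (R : realType) (X : zmodType) (norm : X -> R) (C : set X) :
    \bar R :=
  ereal_sup [set (norm (p.1 - p.2))%:E | p in C `*` C].

(* [U] is only relevant on [C]: a map from [C] to [C] is represented by a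
   function on the whole space that stabilizes [C]. *)
Definition nonexpansive_on (R : realType) (X : zmodType) (norm : X -> R)
    (C : set X) (U : X -> X) : Prop :=
  forall x y, C x -> C y -> norm (U x - U y) <= norm (x - y).

Definition running_max (f : nat -> nat) (n : nat) : nat :=
  \max_(k < n.+1) f k.

(* Main.v *)
(** Put [g n := max_(k <= n) f k + 1] and [w i := g^(i)(0)]. If no [N <= w r]
    works, then every point with [|U x - x| < 1 / g N] can be replaced by a
    point [y] with [|U y - y| <= 1 / (N + 1)] whose squared distance to [v0] is
    smaller by at least [1 / (k + 1)]. Since [g (w i) = w (i + 1)], this can be
    done successively for [N = w r, ..., w 0], starting from an approximate
    fixed point of [U]; the [r + 1] steps would decrease the squared distance
    by [b^2 + 1 / (k + 1)] in total, more than the squared diameter. *)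
Require Import Defs.
From HB Require Import structures.
From mathcomp Require Import all_boot all_order all_algebra.
From mathcomp Require Import sesquilinear.
From mathcomp Require Import all_classical all_reals all_analysis.
From mathcomp Require Import complex ring lra.

Set Implicit Arguments.
Unset Strict Implicit.
Unset Printing Implicit Defensive.

Import Order.TTheory GRing.Theory Num.Theory.
Import numFieldNormedType.Exports.

Local Open Scope classical_set_scope.
Local Open Scope ring_scope.

Definition scalar_of_real (R : realType) (s : scalars) :
    R -> scalar_field R s :=
  match s return R -> scalar_field R s with
  | RealScalars => idfun
  | ComplexScalars => real_complex R
  end.

Section Scalars.
Variables (R : realType) (s : scalars).
Implicit Types (t : R) (z : scalar_field R s).

Lemma scalar_of_real1 : scalar_of_real s 1 = 1 :> scalar_field R s.
Proof. by case: s. Qed.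

Lemma scalar_of_realB t t' :
  scalar_of_real s (t - t') = scalar_of_real s t - scalar_of_real s t'.
Proof. by case: s => //=; exact: rmorphB. Qed.

Lemma scalar_of_real_ge0 t : (0 <= scalar_of_real s t) = (0 <= t).
Proof. by case: s => //=; exact: ler0c. Qed.

Lemma scalar_reD z z' : scalar_re (z + z') = scalar_re z + scalar_re z'.
Proof. by move: z z'; case: s => //= -[? ?] [? ?]. Qed.

Lemma scalar_reM t z : scalar_re (scalar_of_real s t * z) = t * scalar_re z.
Proof. by move: z; case: s => //= -[? ?] /=; rewrite mul0r subr0. Qed.

Lemma scalar_re_conj z : scalar_re (scalar_conj z) = scalar_re z.
Proof. by move: z; case: s => //= -[]. Qed.

Lemma scalar_re_gt0 z : 0 < z -> 0 < scalar_re z.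
Proof. by move: z; case: s => //= z; rewrite ltcE => /andP[]. Qed.

End Scalars.

Section Norm.
Variables (R : realType) (s : scalars) (X : lmodType (scalar_field R s)).
Variable ip : inner_product R s X.
Implicit Types (x y z : X) (t : R).

(** The real part of [ip] is a symmetric, positive definite form, bilinear over the reals, and it
    induces the same norm. Working with it treats both scalar fields at once. *)
Let B x y : R := scalar_re (ip x y).

Let BC x y : B x y = B y x.
Proof.
rewrite /B -[RHS]scalar_re_conj; congr scalar_re.
by rewrite hermitian_subproof expr0 mul1r.
Qed.

Let BDl x y z : B (x + y) z = B x z + B y z.
Proof. by rewrite /B linearDl scalar_reD. Qed.

Let BDr x y z : B z (x + y) = B z x + B z y.
Proof. by rewrite BC BDl !(BC z). Qed.

Let BZl t x y : B (scalar_of_real s t *: x) y = t * B x y.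
Proof. by rewrite /B linearZl_LR scalar_reM. Qed.

Let BZr t x y : B y (scalar_of_real s t *: x) = t * B y x.
Proof. by rewrite BC BZl BC. Qed.

Let B_gt0 x : x != 0 -> 0 < B x x.
Proof. by move=> x0; exact/scalar_re_gt0/neq0_dnorm_gt0. Qed.

Let B0 x : B 0 x = 0.
Proof. by have := BDl 0 0 x; rewrite addr0; lra. Qed.

Let B_ge0 x : 0 <= B x x.
Proof. by have [->|/B_gt0/ltW//] := eqVneq x 0; rewrite B0. Qed.

Local Notation norm := (ip_norm ip).

Lemma ip_norm_ge0 x : 0 <= norm x.
Proof. exact: sqrtr_ge0. Qed.

Lemma ip_norm_sqr x : norm x ^+ 2 = scalar_re (ip x x).
Proof. by rewrite sqr_sqrtr// B_ge0. Qed.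

Lemma ip_normZ t x : 0 <= t -> norm (scalar_of_real s t *: x) = t * norm x.
Proof.
move=> t0; rewrite /ip_norm -!/(B _ _) BZl BZr mulrA -expr2.
by rewrite sqrtrM ?sqr_ge0// sqrtr_sqr ger0_norm.
Qed.

(** For nonzero vectors, the square norm of [|y| x - |x| y] equals [2 |x| |y| (|x| |y| - B x y)]; it
    is nonnegative and the first factors are positive. *)
Lemma ip_norm_cauchy_schwarz x y : scalar_re (ip x y) <= norm x * norm y.
Proof.
rewrite -/(B x y).
have [->|x0] := eqVneq x 0; first by rewrite B0 mulr_ge0// ip_norm_ge0.
have [->|y0] := eqVneq y 0.
  by rewrite BC B0 mulr_ge0// ip_norm_ge0.
have nx : 0 < norm x by rewrite sqrtr_gt0 B_gt0.
have ny : 0 < norm y by rewrite sqrtr_gt0 B_gt0.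
have := B_ge0 (scalar_of_real s (norm y) *: x
  + scalar_of_real s (- norm x) *: y).
rewrite !(BDl, BDr, BZl, BZr) (BC y x).
rewrite {1}/B {3}/B -!ip_norm_sqr.
set a := norm x; set c := norm y; set d := B x y.
have -> : c * (c * a ^+ 2 + - a * d) + - a * (c * d + - a * c ^+ 2) =
    (a * c) *+ 2 * (a * c - d) by ring.
by rewrite pmulr_rge0 ?subr_ge0// pmulrn_lgt0// mulr_gt0.
Qed.

Lemma ip_normD x y : norm (x + y) <= norm x + norm y.
Proof.
rewrite -(@ler_pXn2r _ 2) ?nnegrE ?addr_ge0 ?ip_norm_ge0//.
rewrite ip_norm_sqr -/(B _ _) BDl !BDr (BC y x) {1}/B {3}/B -!ip_norm_sqr.
have := ip_norm_cauchy_schwarz x y; rewrite -/(B _ _); nra.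
Qed.

End Norm.

Section ApproximateFixedPoints.
Variables (R : realType) (s : scalars) (X : lmodType (scalar_field R s)).
Variables (ip : inner_product R s X) (C : set X) (U : X -> X) (b : R).
Local Notation norm := (ip_norm ip).

(** Adapter to real weights: [convex_set] takes its weights in the unit interval of the scalar
    field. *)
Lemma convex_set_combination (t : R) (x y : X) :
  convex_set C -> 0 <= t -> t <= 1 -> C x -> C y ->
  C (scalar_of_real s t *: x + scalar_of_real s (1 - t) *: y).
Proof.
move=> convC t0 t1 Cx Cy.
have st0 : 0 <= scalar_of_real s t by rewrite scalar_of_real_ge0.
have st1 : scalar_of_real s t <= 1.
  rewrite -subr_ge0 -scalar_of_real1 -scalar_of_realB.
  by rewrite scalar_of_real_ge0 subr_ge0.
have := convC x y (Itv01 st0 st1).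
by rewrite !inE scalar_of_realB scalar_of_real1 => /(_ Cx Cy).
Qed.

(* Picard iteration of the contraction [x |-> t v0 + (1 - t) U x], which moves
   points by at most [t b] from [U x]; no completeness is needed since only an
   almost fixed point of the contraction is required. *)
Lemma approximate_fixed_point (v0 : X) (e : R) :
  convex_set C -> (forall x y, C x -> C y -> norm (x - y) <= b) ->
  (forall x, C x -> C (U x)) -> nonexpansive_on norm C U -> C v0 -> 0 < e ->
  exists2 x, C x & norm (U x - x) < e.
Proof.
move=> convC diamC CU neU Cv0 e0.
have b0 : 0 <= b by exact: le_trans (ip_norm_ge0 _ _) (diamC _ _ Cv0 Cv0).
have be0 : 0 < b + e by rewrite ltr_wpDl.
(* This [t] gives [t < 1] and [2 t b < e]. The final estimate is [|U x - x| <= t b + b (1 - t)^n],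
   with [n] such that [(1 - t)^n < t]. *)
pose t := e / (2 * (b + e)).
have tE : t * (b + e) = e / 2 by rewrite /t; field; rewrite gt_eqF.
have t0 : 0 < t by rewrite divr_gt0// mulr_gt0.
have t1 : t < 1 by nra.
have tb : t * b < e / 2 by nra.
pose T x := scalar_of_real s t *: v0 + scalar_of_real s (1 - t) *: U x.
have CT n : C (iter n T v0).
  elim: n => //= n IH.
  by apply: convex_set_combination => //; [exact: ltW|exact: ltW|exact: CU].
(* The [v0] terms cancel in differences, so [T] contracts distances on [C] by the factor [1 - t]. *)
have step n : norm (iter n.+1 T v0 - iter n T v0) <= b * (1 - t) ^+ n.
  elim: n => [|n IH]; first by rewrite expr0 mulr1; exact: diamC (CT 1%N) Cv0.
  rewrite iterS [in X in _ - X]iterS {1 3}/T opprD addrACA subrr.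
  rewrite add0r -scalerBr.
  rewrite ip_normZ ?subr_ge0 ?(ltW t1)// exprS mulrCA.
  rewrite ler_wpM2l ?subr_ge0 ?(ltW t1)//.
  exact: le_trans (neU _ _ (CT n.+1) (CT n)) IH.
have /cvgrPdist_lt/(_ t t0) : (fun n => (1 - t) ^+ n) @ \oo --> (0 : R).
  by apply: cvg_expr; rewrite ger0_norm ?subr_ge0 ?(ltW t1)// gtrBl.
move=> [n _ /(_ n (leqnn n))].
rewrite /= sub0r normrN ger0_norm ?exprn_ge0 ?subr_ge0 ?(ltW t1)// => tn.
exists (iter n T v0) => //; set x := iter n T v0.
have -> : U x - x = (U x - T x) + (T x - x) by rewrite addrA subrK.
apply: le_lt_trans (ip_normD _ _ _) _.
have -> : U x - T x = scalar_of_real s t *: (U x - v0).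
  rewrite /T scalar_of_realB scalar_of_real1 scalerBl scale1r scalerBr.
  by rewrite opprD opprB addrC addrA subrK addrC.
rewrite ip_normZ ?(ltW t0)//.
have Ub : norm (U x - v0) <= b by apply: diamC => //; exact/CU/CT.
have := step n; rewrite iterS -/x; nra.
Qed.

End ApproximateFixedPoints.

Theorem proposition3p1 (R : realType) (s : scalars)
    (X : lmodType (scalar_field R s)) (ip : inner_product R s X)
    (C : set X) (b : nat) (U : X -> X) (v0 : X)
    (norm := ip_norm ip) :
  convex_set C ->
  (0 < b)%N ->
  (diameter norm C <= b%:R%:E)%E ->
  (forall x, C x -> C (U x)) ->
  nonexpansive_on norm C U ->
  C v0 ->
  forall (k : nat) (f : nat -> nat),
  let r := (b ^ 2 * k.+1)%N in
  exists N : nat,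
    (N <= iter r (fun n => (running_max f n).+1) 0)%N /\
    exists x : X, C x /\
      norm (U x - x) < 1 / (running_max f N).+1%:R /\
      forall y : X, C y ->
        norm (U y - y) <= 1 / N.+1%:R ->
        norm (x - v0) ^+ 2 < norm (y - v0) ^+ 2 + 1 / k.+1%:R.
Proof.
move=> convC _ diamC CU neU Cv0 k f r.
have normC x y : C x -> C y -> norm (x - y) <= b%:R.
  move=> Cx Cy; rewrite -lee_fin; apply: le_trans diamC.
  by apply: ereal_sup_ubound; exists (x, y).
set g := fun n => (running_max f n).+1; pose w i := iter i g 0%N.
(* Monotonicity makes every [w i] with [i <= r] an admissible [N]. *)
have w_le i j : (i <= j)%N -> (w i <= w j)%N.
  have g_mono m n : (m <= n)%N -> (g m <= g n)%N.
    move=> mn; rewrite ltnS; apply/bigmax_leqP => l _.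
    exact: (leq_bigmax (widen_ord (mn : (m.+1 <= n.+1)%N) l)).
  have w_leS n : (w n <= w n.+1)%N by elim: n => // n; exact: g_mono.
  exact: (homo_leq leqnn leq_trans w_leS).
apply: contrapT => none.
have improve N x : (N <= w r)%N -> C x -> norm (U x - x) < 1 / (g N)%:R ->
    exists y, [/\ C y, norm (U y - y) <= 1 / N.+1%:R &
      norm (y - v0) ^+ 2 + 1 / k.+1%:R <= norm (x - v0) ^+ 2].
  move=> Nr Cx Ux; apply: contrapT => noy; apply: none; exists N; split=> //.
  exists x; do 2!split=> //; move=> y Cy Uy; rewrite ltNge; apply/negP => xy.
  by apply: noy; exists y.
(* After [j] improvements the next one uses [N = w (r - j)], whose threshold is
   [g N = w (r - j).+1]. The guard [j <= r] excludes the state after the last improvement, made at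
   [w 0 = 0], where truncated subtraction would still ask for the threshold [w 1]. *)
have descend j : (j <= r.+1)%N -> exists y, [/\ C y,
    (j <= r)%N -> norm (U y - y) < 1 / (w (r - j).+1)%:R &
    norm (y - v0) ^+ 2 + j%:R / k.+1%:R <= b%:R ^+ 2].
  elim: j => [_|j IH jr].
    have g0 : 0 < 1 / (w (r - 0).+1)%:R :> R by rewrite divr_gt0.
    have [x Cx Ux] := approximate_fixed_point convC normC CU neU Cv0 g0.
    exists x; split=> //; rewrite mul0r addr0 lerXn2r ?nnegrE ?ip_norm_ge0//.
    exact: normC.
  have [x [Cx Ux xb]] := IH (ltnW jr).
  have wr : (w (r - j) <= w r)%N by rewrite w_le// leq_subr.
  have [y [Cy Uy yx]] := improve _ x wr Cx (Ux jr).
  exists y; split=> // [jr'|]; last first.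
    apply: le_trans xb; rewrite -[j.+1%:R]natr1 mulrDl.
    by rewrite addrCA [leRHS]addrC lerD2l.
  (* With [N = w (r - j)], the bound obtained is [1 / (N + 1)] and the one required is [1 / N],
     hence the strict inequality. *)
  apply: le_lt_trans Uy _; rewrite -(subnSK jr') !div1r.
  by rewrite ltf_pV2 ?posrE// ltr_nat.
have [//|y [_ _]] := descend r.+1.
apply/negP; rewrite -ltNge.
have -> : r.+1%:R / k.+1%:R = b%:R ^+ 2 + k.+1%:R^-1 :> R.
  by rewrite -natr1 /r natrM natrX mulrDl mulfK ?pnatr_eq0// mul1r.
by rewrite addrCA ltrDl ltr_wpDl ?sqr_ge0// invr_gt0.
Qed.
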